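(* Let $q$ be a prime power and let $h\ge2$. Let $\mathcal C$ be a faithful hypergraphic additive code over $\mathbb F_{q^h}$ and let $H=(V,\mathcal E,\psi_H)$ be a connected underlying hypergraph of $\mathcal C$ with $N$ vertices and $m$ edges (so $H$ is $(h+1)$-uniform, $\mathcal C$ has length $m$ and $\mathbb F_q$-dimension $N-1$). Set $\sigma:=\lceil(N-1)/h\rceil$. The following hold. (i) If $\sigma=1$, then $N=h+1$, every edge is equal to $V$, and $\mathcal C$ is QMDS with $d(\mathcal C)=m$. (ii) If $\sigma=2$, set $\overline e:=V\setminus e$ for $e\in\mathcal E$. Then $\mathcal C$ is QMDS if and only if the sets $\overline e$, $e\in\mathcal E$, are pairwise disjoint, and in that case $d(\mathcal C)=m-1$. (iii) If $\sigma\ge3$, then $\mathcal C$ is QMDS if and only if either $m=\sigma$, in which case $d(\mathcal C)=1$, or $\sigma=3$, $m=4$, $N=2h+2$, every vertex lies in exactly two edges, and deleting any one edge leaves a connected spanning hypergraph, in which case $d(\mathcal C)=2$. Consequently, if $N>h+1$, every QMDS code in this class with $d(\mathcal C)\ge2$ has length $m\le h+2$. This bound is attained for every $h\ge2$ and every prime power $q$.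
   Context: A finite hypergraph is a triple $H=(V,\mathcal E,\psi_H)$ with finite sets $V$, $\mathcal E$ and a map $\psi_H:\mathcal E\to2^V\setminus\{\emptyset\}$ (distinct edges may have the same vertex set; $e$ is identified with $\psi_H(e)$, and families indexed by $\mathcal E$ are indexed by edges, not by vertex sets). Vertices are in the same component if joined by a walk $u_0,e_1,u_1,\ldots,e_\ell,u_\ell$ with $u_{i-1},u_i\in e_i$; $H$ is connected if it has one component. For $A\subseteq\mathcal E$, the spanning subhypergraph is $H_A=(V,A,\psi_H|_A)$, $\kappa(A)$ is its number of components, isolated vertices included, and $f_H(A):=|V|-\kappa(A)$. ''Deleting $e$ leaves a connected spanning hypergraph'' means that $H_{\mathcal E\setminus\{e\}}$ (on all of $V$) is connected. An additive code $\mathcal C\subseteq\mathbb F_{q^h}^n$ is an $\mathbb F_q$-subspace, of $\mathbb F_q$-dimension $k$ say; $d(\mathcal C)$ is the minimum Hamming weight of a nonzero codeword. It satisfies the Singleton bound $d(\mathcal C)\le n-\lceil k/h\rceil+1$ and is called QMDS (quasi-MDS) if equality holds. It is nondegenerate (faithful) if every coordinate map $\mathcal C\to\mathbb F_{q^h}$, $c\mapsto c_i$, is nonzero (surjective). For a set $A$ of coordinates, $\mathcal C(A)$ is the subspace of codewords vanishing on $A$ and $\rho_{\mathcal C}(A):=k-\dim_{\mathbb F_q}\mathcal C(A)$. A nondegenerate additive code is hypergraphic if there is a hypergraph $H$ whose edge set is the set $\{1,\ldots,n\}$ of coordinates with $\rho_{\mathcal C}=f_H$; any such $H$ is an underlying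 hypergraph of $\mathcal C$. ''This class'' means the class of faithful hypergraphic additive codes over $\mathbb F_{q^h}$ with a connected underlying hypergraph, $h\ge 2$. *)

(* Defs.v *)
From HB Require Import structures.
From mathcomp Require Import all_boot all_order all_fingroup all_algebra all_field.

Set Implicit Arguments.
Unset Strict Implicit.
Unset Printing Implicit Defensive.

Import GRing.Theory.

Local Open Scope ring_scope.

Definition prime_power (q : nat) : Prop :=
  exists p k : nat, [/\ prime p, (0 < k)%N & q = (p ^ k)%N].

Definition ceil_div (k h : nat) : nat := (k %/ h + ~~ (h %| k))%N.

(* Edges are indexed by E, so distinct edges may have the same vertex set. *)
Record hypergraph (V E : finType) := Hypergraph {
  edge_set :> E -> {set V};
  edge_set_neq0 : forall e, edge_set e != set0 }.

Section Hypergraphs.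
Variables (V E : finType) (H : hypergraph V E).
Implicit Type A : {set E}.

(* One step of a walk using only edges of A; two vertices lie in the same
   component of the spanning subhypergraph (V, A) iff they are related by
   [connect (hadj A)]. *)
Definition hadj A : rel V :=
  fun u v => [exists e in A, (u \in H e) && (v \in H e)].

Lemma hadj_connect_sym A : connect_sym (hadj A).
Proof.
apply: sym_connect_sym => u v; rewrite /hadj.
by apply: eq_existsb => e; rewrite (andbC (u \in _)).
Qed.

Definition hcomp A : nat := n_comp (hadj A) V.

Definition spanning_connected A : Prop := hcomp A = 1%N.

Definition hconnected : Prop := spanning_connected [set: E].

Definition hrank A : nat := (#|V| - hcomp A)%N.

Definition huniform (r : nat) : Prop := forall e, #|H e| = r.

End Hypergraphs.

(* With #|F| = q and \dim {:L} = h, L is the field with q^h elements. Words are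
   taken in {ffun 'I_m -> L}, which is a vector space over F, so that its
   vspaces are exactly the F-subspaces; ('rV[L]_m is only a vectType over L). *)
Definition additive_code (F : finFieldType) (L : fieldExtType F) (m : nat) :=
  {vspace {ffun 'I_m -> L}}.

Section AdditiveCodes.
Variables (F : finFieldType) (L : fieldExtType F) (m : nat).
Implicit Types (C : additive_code L m) (A : {set 'I_m}).

Definition hweight (c : {ffun 'I_m -> L}) : nat := #|[set i | c i != 0]|.

(* [finvect_type L] is L with its finType structure. As weights are at most m,
   the default value m only matters for the zero code. *)
Definition min_dist C : nat :=
  \big[minn/m]_(c : {ffun 'I_m -> finvect_type L}
                | ((c : {ffun 'I_m -> L}) \in C) && (c != 0)) hweight c.

Lemma min_dist_le C (c : {ffun 'I_m -> L}) :
  c \in C -> c != 0 -> (min_dist C <= hweight c)%N.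
Proof.
move=> cC c0; rewrite /min_dist -big_filter.
have: (c : {ffun 'I_m -> finvect_type L}) \in
   [seq i <- index_enum {ffun 'I_m -> finvect_type L}
      | ((i : {ffun 'I_m -> L}) \in C) && (i != 0)].
  by rewrite mem_filter mem_index_enum andbT; apply/andP.
elim: [seq _ <- _ | _] => // a s IH.
rewrite big_cons inE => /orP[/eqP->|/IH le_c]; first exact: geq_minl.
by rewrite geq_min le_c orbT.
Qed.

Lemma min_dist_attained C : C != 0%VS ->
  exists2 c : {ffun 'I_m -> L}, (c \in C) && (c != 0) & min_dist C = hweight c.
Proof.
move=> C0; have c0C : vpick C \in C by apply: memv_pick.
have c0 : vpick C != 0 by rewrite vpick0.
pose P := fun c : {ffun 'I_m -> finvect_type L} =>
  ((c : {ffun 'I_m -> L}) \in C) && (c != 0).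
have P0 : P (vpick C) by apply/andP.
case: (@arg_minnP {ffun 'I_m -> finvect_type L} (vpick C) P
          (fun c => hweight c) P0) => c cP cmin.
exists c => //; apply/eqP; rewrite eqn_leq; apply/andP; split.
  by case/andP: cP; apply: min_dist_le.
rewrite /min_dist; elim/big_ind: _ => [|x y hx hy|c' /cmin//].
  by rewrite -[X in (_ <= X)%N](card_ord m) max_card.
by rewrite leq_min hx.
Qed.

(* No truncation occurs: \dim C <= \dim {:L} * m. *)
Definition QMDS C : Prop :=
  min_dist C = (m - ceil_div (\dim C) (\dim {:L}) + 1)%N.

Definition nondegenerate C : Prop :=
  forall i : 'I_m, exists2 c, c \in C & c i != 0.

Definition faithful_code C : Prop :=
  forall (i : 'I_m) (x : L), exists2 c, c \in C & c i = x.

Definition coord_fun (i : 'I_m) (c : {ffun 'I_m -> L}) : L := c i.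

Fact coord_fun_is_linear i : linear (coord_fun i).
Proof. by move=> a c d; rewrite /coord_fun !ffunE. Qed.

HB.instance Definition _ i :=
  GRing.isLinear.Build F {ffun 'I_m -> L} L _ (coord_fun i)
    (coord_fun_is_linear i).

Definition shortened C A : additive_code L m :=
  (C :&: \bigcap_(i in A) lker (linfun (coord_fun i)))%VS.

Lemma mem_shortened C A c :
  (c \in shortened C A) = (c \in C) && [forall i in A, c i == 0].
Proof.
rewrite memv_cap; congr (_ && _).
rewrite memvE; apply/subv_bigcapP/forall_inP => cA i /cA.
  by rewrite -memvE memv_ker lfunE.
by rewrite -memvE memv_ker lfunE.
Qed.

Definition code_rank C A : nat := (\dim C - \dim (shortened C A))%N.

Definition underlying_hypergraph (V : finType) C (H : hypergraph V 'I_m) : Prop :=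
  forall A, code_rank C A = hrank H A.

Definition hypergraphic C : Prop :=
  nondegenerate C /\
  exists (V : finType) (H : hypergraph V 'I_m), underlying_hypergraph C H.

(* C is a faithful hypergraphic code with connected underlying hypergraph H. *)
Definition connected_hypergraphic (V : finType) C (H : hypergraph V 'I_m) : Prop :=
  [/\ faithful_code C, hypergraphic C, underlying_hypergraph C H
    & hconnected H].

End AdditiveCodes.

(* Main.v *)
(** The codewords vanishing on A form a space of dimension kappa(A) - 1, so the
    minimum distance is the edge connectivity of H, and the code is QMDS iff any
    sigma edges form a connected spanning hypergraph. For sigma <= 2 this can be
    read off directly. For sigma >= 3, connectivity of any sigma edges forces every
    vertex to have degree at least m - sigma + 1; counting incidences gives
    N (m - sigma + 1) <= m (h + 1), which together with N >= h (sigma - 1) + 2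
    leaves only m = sigma or (sigma, m) = (3, 4) with all estimates tight.
    Length h + 2 is attained by the words (x + a t_i)_i, x in L and a in F, where
    the t_i are h + 2 distinct elements of L: a nonzero such word has at most one
    zero, so the rank function is that of the hypergraph of all complements of
    points in a set of h + 2 vertices. *)
Require Import Defs.
From HB Require Import structures.
From mathcomp Require Import all_boot all_order all_fingroup all_algebra all_field.
From mathcomp Require Import zify.

Set Implicit Arguments.
Unset Strict Implicit.
Unset Printing Implicit Defensive.

Import GRing.Theory.

(** The adjunction that characterises the ceiling; through it, bounds on [sigma] become inequalities
    between products. *)
Lemma ceil_div_leE (k h s : nat) : 0 < h -> (ceil_div k h <= s) = (k <= h * s).
Proof.
move=> h0; rewrite /ceil_div {3}(divn_eq k h) /dvdn.
have := ltn_pmod k h0; case: eqP => /= [->|] *; apply/idP/idP; nia.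
Qed.

(** * Connectivity of spanning subhypergraphs and ranks of small edge sets *)

Section HypergraphTheory.
Variables (V E : finType) (H : hypergraph V E).
Implicit Types A B : {set E}.

Lemma hcomp_le A : hcomp H A <= #|V|.
Proof. exact: max_card. Qed.

Lemma hcomp_gt0 A : 0 < #|V| -> 0 < hcomp H A.
Proof.
case/card_gt0P => x _; apply/card_gt0P; exists (fingraph.root (hadj H A) x).
rewrite !inE andbT; apply: roots_root; exact: hadj_connect_sym.
Qed.

Lemma spanning_connectedP A : 0 < #|V| ->
  spanning_connected H A <-> forall u v, connect (hadj H A) u v.
Proof.
have sy := hadj_connect_sym H A; move=> V0; split=> [/eqP|con].
  case/card1P => x rx u v.
  have rt w : fingraph.root (hadj H A) w = x.
    apply/eqP; move: (rx (fingraph.root (hadj H A) w)).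
    by rewrite !inE roots_root //= => <-.
  by rewrite -root_connect // !rt.
case/card_gt0P: V0 => x _; apply/eqP/card1P; exists (fingraph.root (hadj H A) x) => y.
rewrite !inE andbT; apply/idP/eqP => [/eqP<-|->]; last exact: roots_root.
by apply/eqP; rewrite root_connect.
Qed.

Lemma spanning_connectedS A B : A \subset B -> 0 < #|V| ->
  spanning_connected H A -> spanning_connected H B.
Proof.
move=> /subsetP AB V0 /(spanning_connectedP _ V0) con.
apply/(spanning_connectedP _ V0) => u v; apply: connect_sub (con u v) => x y.
case/existsP => e /andP[eA xy]; apply/connect1/existsP; exists e.
by rewrite AB.
Qed.

(** A walk from [v] to some other vertex is not empty, and its first edge contains [v]. *)
Lemma spanning_connected_cover A v : 1 < #|V| -> spanning_connected H A ->
  exists2 e, e \in A & v \in H e.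
Proof.
move=> V1 /(spanning_connectedP _ (ltnW V1)) con.
have /card_gt0P[w] : 0 < #|[set~ v]| by rewrite cardsC1; lia.
rewrite !inE => wv; case/connectP: (con v w) => [[|x p]] /=.
  by move=> _ wE; rewrite wE eqxx in wv.
by case/andP => /existsP[e /and3P[eA ve _]] _ _; exists e.
Qed.

(** By inclusion-exclusion the size condition gives a common vertex [w], and every vertex is one
    step away from [w]. The case [e = f] is allowed and serves [sigma = 1]. *)
Lemma spanning_connected_two A e f : e \in A -> f \in A ->
  H e :|: H f = [set: V] -> #|V| < #|H e| + #|H f| -> spanning_connected H A.
Proof.
move=> eA fA UV; rewrite -cardsUI UV cardsT -[X in X < _]addn0 ltn_add2l.
case/card_gt0P => w; rewrite inE => /andP[we wf].
have V0 : 0 < #|V| by apply/card_gt0P; exists w.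
apply/(spanning_connectedP _ V0).
have cw u : connect (hadj H A) u w.
  have: u \in H e :|: H f by rewrite UV.
  rewrite inE => /orP[ue|uf]; apply/connect1/existsP.
    by exists e; rewrite eA ue.
  by exists f; rewrite fA uf.
move=> u v; apply: connect_trans (cw u) _.
by rewrite (hadj_connect_sym H A).
Qed.

Lemma hrank0 : hrank H set0 = 0.
Proof.
rewrite /hrank [hcomp H set0](_ : _ = #|V|) ?subnn //.
apply: eq_card => x; rewrite !inE andbT; apply/eqP.
apply/esym/eqP; have := connect_root (hadj H set0) x.
case/connectP => [[|y p]] /=; first by move=> _ ->.
by case/andP => /existsP[e]; rewrite inE.
Qed.

(** The components are the edge itself and the single vertices outside it, so there are
    [#|V| - #|H e| + 1] of them. *)
Lemma hrank1 e : hrank H [set e] = #|H e| - 1.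
Proof.
pose a := hadj H [set e].
have sy : connect_sym a := hadj_connect_sym H _.
have aE u v : a u v = (u \in H e) && (v \in H e).
  apply/existsP/idP => [[f]|uv]; first by rewrite inE => /andP[/eqP->].
  by exists e; rewrite inE eqxx.
have [x0 x0e] : exists x0, x0 \in H e by apply/set0Pn/edge_set_neq0.
(* A walk is either trivial or stays inside the only edge. *)
have clo u v : connect a u v -> (u == v) || (u \in H e) && (v \in H e).
  case/connectP => p; elim: p u => [|w p IH] u /=; first by move=> _ ->; rewrite eqxx.
  rewrite aE => /andP[/andP[-> we] /IH pw] /pw; rewrite we.
  by case/orP => [/eqP<-|->]; rewrite ?we orbT.
have re : fingraph.root a x0 \in H e.
  by have /clo := connect_root a x0; case/orP => [/eqP<-//|/andP[]].
(* Components are counted by their roots: each vertex off [e] is its own root, and all vertices of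
   [e] share the root of [x0]. *)
have rE : [predI roots a & V] =i ~: H e :|: [set fingraph.root a x0].
  move=> x; rewrite !inE andbT /roots /=.
  case xe: (x \in H e) => /=.
    have -> : fingraph.root a x = fingraph.root a x0.
      by apply/eqP; rewrite root_connect //; apply/connect1; rewrite aE xe.
    by rewrite eq_sym.
  by have /clo := connect_root a x; rewrite xe /= orbF eq_sym.
rewrite /hrank /hcomp /n_comp_mem (eq_card rE) setUC cardsU1 inE re.
by have := cardsC (H e); lia.
Qed.
End HypergraphTheory.

(** * Shortened codes, their dimensions and the minimum distance *)

Section CodeTheory.
Variables (F : finFieldType) (L : fieldExtType F) (m : nat).
Variable C : additive_code L m.
Implicit Types A : {set 'I_m}.
Local Notation h := (\dim {:L}).

Lemma shortened0 : shortened C set0 = C.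
Proof. by rewrite /shortened big_set0 capvf. Qed.

Lemma shortenedT : shortened C [set: 'I_m] = 0%VS.
Proof.
apply/eqP; rewrite -subv0; apply/subvP => c; rewrite mem_shortened memv0.
case/andP => _ /forall_inP c0; apply/eqP/ffunP => i; rewrite ffunE.
exact/eqP/c0.
Qed.

Lemma shortenedU1 i A :
  shortened C (i |: A) = (shortened C A :&: lker (linfun (coord_fun (L:=L) i)))%VS.
Proof.
apply/vspaceP => c; rewrite memv_cap !mem_shortened memv_ker lfunE /= -andbA.
congr (_ && _); apply/forall_inP/andP => [c0|[/forall_inP cA ci] j].
  split; last by apply: c0; rewrite setU11.
  by apply/forall_inP => j jA; apply: c0; rewrite setU1r.
by rewrite !inE => /orP[/eqP->//|/cA].
Qed.

Lemma dim_shortened_le A : \dim (shortened C A) <= \dim C.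
Proof. exact/dimvS/capvSl. Qed.

Lemma code_rankT : code_rank C [set: 'I_m] = \dim C.
Proof. by rewrite /code_rank shortenedT dimv0 subn0. Qed.

(** Rank-nullity for the coordinate map on [C]: its kernel is the shortened code, and its image is
    all of [L] by faithfulness. *)
Lemma code_rank1 i : faithful_code C -> code_rank C [set i] = h.
Proof.
move=> fC; rewrite /code_rank -(setU0 [set i]) shortenedU1 shortened0.
rewrite -(limg_ker_dim (linfun (coord_fun (L:=L) i)) C) addKn.
congr (\dim _); apply/vspaceP => x; rewrite memvf.
have [c cC <-] := fC i x; apply/memv_imgP; exists c => //.
by rewrite lfunE.
Qed.

(** Each further zero coordinate costs at most [h] dimensions, the coordinate map having its image
    in [L]. The Singleton bound comes from this. *)
Lemma dim_shortened_ge A : \dim C <= \dim (shortened C A) + h * #|A|.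
Proof.
have [n] := ubnP #|A|; elim: n => // n IH in A *; rewrite ltnS => An.
have [->|[i iA]] := set_0Vmem A; first by rewrite shortened0 leq_addr.
rewrite -(setD1K iA) shortenedU1 cardsU1 !inE eqxx /= mulnDr muln1.
have := cardsD1 i A; rewrite iA => cA.
have /IH : #|A :\ i| < n by lia.
move/leq_trans; apply.
rewrite -(limg_ker_dim (linfun (coord_fun (L:=L) i)) (shortened C (A :\ i))).
by rewrite -addnA leq_add2l leq_add2r dimvS ?subvf.
Qed.

Lemma sigma_le_length : ceil_div (\dim C) h <= m.
Proof.
rewrite ceil_div_leE ?adim_gt0 //; have := dim_shortened_ge setT.
by rewrite shortenedT dimv0 cardsT card_ord.
Qed.

Lemma hweightE (c : {ffun 'I_m -> L}) :
  hweight c = m - #|[set i | c i == 0%R]|.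
Proof.
apply: (@addnI #|[set i | c i == 0%R]|); rewrite subnKC; last first.
  by rewrite -[X in _ <= X]card_ord max_card.
rewrite -[RHS]card_ord -(cardsC [set i | c i == 0%R]); congr (_ + _).
by apply: eq_card => i; rewrite !inE.
Qed.

Lemma dim_shortened_min_dist A :
  0 < \dim (shortened C A) -> min_dist C <= m - #|A|.
Proof.
rewrite lt0n dimv_eq0 -vpick0 => c0.
have := memv_pick (shortened C A); set c := vpick _ in c0 *.
rewrite mem_shortened => /andP[cC /forall_inP cA].
apply: leq_trans (min_dist_le cC c0) _; rewrite hweightE leq_sub2l //.
by apply/subset_leq_card/subsetP => i /cA; rewrite inE.
Qed.

(** [A] is the zero set of a word of minimum weight. With the previous lemma, [min_dist C] is [m]
    minus the largest number of coordinates on which a nonzero codeword can vanish. *)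
Lemma min_dist_shortened : C != 0%VS ->
  exists2 A, 0 < \dim (shortened C A) & min_dist C = m - #|A|.
Proof.
move=> /min_dist_attained[c /andP[cC c0] ->]; rewrite hweightE.
exists [set i | c i == 0%R] => //; rewrite lt0n dimv_eq0.
apply: contraNneq c0 => s0; rewrite -memv0 -s0 mem_shortened cC.
by apply/forall_inP => i; rewrite inE.
Qed.

End CodeTheory.

(** * Translation between the code and its connected hypergraph *)

Section ConnectedHypergraphic.
Variables (F : finFieldType) (L : fieldExtType F) (m : nat).
Variables (C : additive_code L m) (V : finType) (H : hypergraph V 'I_m).
Hypothesis CH : connected_hypergraphic C H.
Implicit Types A : {set 'I_m}.
Local Notation h := (\dim {:L}).
Local Notation sigma := (ceil_div (#|V| - 1) h).

Let dimL_gt0 : 0 < h. Proof. exact: adim_gt0. Qed.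

Lemma vertices_gt0 : 0 < #|V|.
Proof.
have [_ _ _ cH] := CH; rewrite lt0n; apply/eqP => V0.
by have := hcomp_le H setT; rewrite cH V0.
Qed.

Lemma hypergraphic_dim : \dim C = #|V| - 1.
Proof. by have [_ _ uH cH] := CH; rewrite -code_rankT uH /hrank cH. Qed.

(** A single coordinate has rank [h] in the code and [#|H e| - 1] in the hypergraph; edges are
    nonempty, so the subtraction does not truncate. *)
Lemma hypergraphic_uniform : huniform H h.+1.
Proof.
move=> e; have [fC _ uH _] := CH.
have := uH [set e]; rewrite code_rank1 // hrank1 => ->.
by have := edge_set_neq0 H e; rewrite -card_gt0; lia.
Qed.

Lemma dim_shortened_hcomp A : \dim (shortened C A) = hcomp H A - 1.
Proof.
have [_ _ uH _] := CH; have := uH A; rewrite /code_rank /hrank.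
have := dim_shortened_le C A; have := hypergraphic_dim.
have := hcomp_le H A; have := hcomp_gt0 H A vertices_gt0; lia.
Qed.

Lemma disconnectedE A :
  ~ spanning_connected H A <-> 0 < \dim (shortened C A).
Proof.
rewrite dim_shortened_hcomp /spanning_connected.
have := hcomp_gt0 H A vertices_gt0; split; lia.
Qed.

Lemma length_ge_sigma : sigma <= m.
Proof. by rewrite -hypergraphic_dim sigma_le_length. Qed.

Lemma QMDS_sigmaE : QMDS C <-> min_dist C = m - sigma + 1.
Proof. by rewrite /QMDS hypergraphic_dim. Qed.

(** A disconnected edge set is one on which some nonzero codeword vanishes, so [sigma] or more
    disconnected edges would push the distance below the Singleton value. Conversely, zero sets of
    nonzero words then have fewer than [sigma] elements. The condition on [#|V|] makes [C]
    nonzero. *)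
Lemma QMDS_connectedP : 1 < #|V| ->
  QMDS C <-> forall A, sigma <= #|A| -> spanning_connected H A.
Proof.
move=> V1; have C0 : C != 0%VS by rewrite -dimv_eq0 hypergraphic_dim; lia.
have sm := length_ge_sigma.
have s0 : 0 < sigma by rewrite ltnNge ceil_div_leE // muln0 -ltnNge; lia.
rewrite QMDS_sigmaE; split=> [dC A sA|conn].
  have [//|/eqP/disconnectedE/dim_shortened_min_dist] := eqVneq (hcomp H A) 1.
  rewrite dC; have := max_card A; rewrite card_ord; lia.
apply/eqP; rewrite eqn_leq; apply/andP; split.
  have s1m : sigma.-1 <= m by lia.
  (* Any [sigma - 1] coordinates would do: [h * sigma.-1 < \dim C], so some nonzero codeword
     vanishes on them. *)
  pose A := [set widen_ord s1m j | j in 'I_sigma.-1].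
  have cA : #|A| = sigma.-1.
    by rewrite card_imset ?card_ord // => i j [/ord_inj].
  have -> : m - sigma + 1 = m - #|A| by lia.
  apply: dim_shortened_min_dist; have := dim_shortened_ge C A.
  rewrite hypergraphic_dim; have : ~~ (sigma <= sigma.-1) by lia.
  rewrite ceil_div_leE // cA; lia.
have [A /disconnectedE dA ->] := min_dist_shortened C0.
have : ~~ (sigma <= #|A|) by apply/negP => /conn.
lia.
Qed.

(** The edges that miss [v] do not cover [v], hence are disconnected, hence number fewer than
    [sigma]. *)
Lemma QMDS_degree : 1 < #|V| -> QMDS C ->
  forall v, m - sigma < #|[set e | v \in H e]|.
Proof.
move=> V1 /(QMDS_connectedP V1) conn v.
have : ~~ (sigma <= #|~: [set e | v \in H e]|).
  apply/negP => /conn /(spanning_connected_cover v V1)[e].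
  by rewrite !inE => /negP.
have := cardsC [set e | v \in H e]; rewrite card_ord.
by have := length_ge_sigma; lia.
Qed.

Lemma sum_degrees : \sum_v #|[set e | v \in H e]| = m * h.+1.
Proof.
under eq_bigr do rewrite -sum1_card.
rewrite (exchange_big_dep xpredT) //=.
rewrite (eq_bigr (fun=> h.+1)) ?sum_nat_const ?card_ord // => e _.
rewrite -(hypergraphic_uniform e) -sum1_card; apply: eq_bigl => v.
by rewrite inE.
Qed.

End ConnectedHypergraphic.

(** * The cases [sigma = 1], [sigma = 2], [sigma >= 3], and the length bound *)

Section Classification.
Variables (F : finFieldType) (L : fieldExtType F) (m : nat).
Variables (C : additive_code L m) (V : finType) (H : hypergraph V 'I_m).
Hypothesis CH : connected_hypergraphic C H.
Hypothesis dimL_ge2 : 1 < \dim {:L}.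
Local Notation h := (\dim {:L}).
Local Notation sigma := (ceil_div (#|V| - 1) h).

Let dimL_gt0 : 0 < h := ltnW dimL_ge2.

Lemma sigma_bounds :
  #|V| - 1 <= h * sigma /\ (0 < sigma -> h * sigma.-1 < #|V| - 1).
Proof.
split; first by rewrite -ceil_div_leE.
by move=> s0; rewrite ltnNge -ceil_div_leE // -ltnNge; lia.
Qed.

Lemma QMDS_sigma1 : sigma = 1 ->
  [/\ #|V| = h + 1, (forall e : 'I_m, H e = [set: V]), QMDS C
    & min_dist C = m].
Proof.
move=> s1; have [le_k lt_k] := sigma_bounds; rewrite s1 in le_k lt_k.
have sm := length_ge_sigma CH.
have edgeN e : #|H e| = h.+1 by apply: hypergraphic_uniform CH e.
have V_eq : #|V| = h + 1.
  (* [sm] becomes [0 < m], so there is an edge, whose [h + 1] vertices bound [#|V|] from below. *)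
  rewrite s1 in sm; have hV : h < #|V| by rewrite -(edgeN (Ordinal sm)) max_card.
  by move: hV le_k; lia.
have eT e : H e = [set: V].
  by apply/eqP; rewrite eqEcard subsetT cardsT edgeN V_eq addn1 leqnn.
have qC : QMDS C.
  apply/(QMDS_connectedP CH); first lia.
  move=> A; rewrite s1 => /card_gt0P[e eA].
  by apply: (spanning_connected_two eA eA); rewrite !eT ?setUid // cardsT; lia.
by split=> //; have /(QMDS_sigmaE CH) -> := qC; lia.
Qed.

(** Disjoint complements mean that two edges cover [V]. They also meet, because [#|V| <= 2 * h + 1]
    is less than the sum of their sizes. *)
Lemma QMDS_sigma2 : sigma = 2 ->
  QMDS C <-> (forall e f : 'I_m, e != f -> [disjoint ~: H e & ~: H f]).
Proof.
move=> s2; have [le_k lt_k] := sigma_bounds; rewrite s2 in le_k lt_k.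
have V1 : 1 < #|V| by lia.
rewrite (QMDS_connectedP CH V1) s2; split=> [conn e f ef|disj A].
  rewrite -setI_eq0 -setCU -subset0; apply/subsetP => v; rewrite !inE.
  have /conn/(spanning_connected_cover v V1)[g] : 2 <= #|[set e; f]|.
    by rewrite cards2 ef.
  by rewrite !inE => /orP[]/eqP-> ->; rewrite ?orbT.
case/card_gt1P => e [f [eA fA ef]].
apply: (spanning_connected_two eA fA).
  by apply: setC_inj; rewrite setCU setCT; apply/eqP; rewrite setI_eq0 disj.
by rewrite !(hypergraphic_uniform CH); lia.
Qed.

Definition exceptional : Prop :=
  [/\ sigma = 3, m = 4, #|V| = 2 * h + 2,
      (forall v : V, #|[set e : 'I_m | v \in H e]| = 2)
    & (forall e : 'I_m, spanning_connected H (~: [set e]))].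

Lemma QMDS_length_eq_sigma : 1 < #|V| -> m = sigma -> QMDS C.
Proof.
move=> V1 ms; apply/(QMDS_connectedP CH V1) => A; rewrite -ms => mA.
have -> : A = setT by apply/eqP; rewrite eqEcard subsetT cardsT card_ord.
by case: CH.
Qed.

Lemma exceptional_QMDS : exceptional -> QMDS C.
Proof.
case=> s3 m4 NV _ conn; have V1 : 1 < #|V| by lia.
apply/(QMDS_connectedP CH V1) => A; rewrite s3 => cA.
(* At least three of four edges contain the complement of one edge; if [A] is everything, any edge
   serves. *)
have [e AE] : exists e, ~: [set e] \subset A.
  have [A0|[e eA]] := set_0Vmem (~: A).
    have m0 : 0 < m by rewrite m4.
    by exists (Ordinal m0); rewrite -(setCK A) A0 setC0 subsetT.
  exists e; rewrite -setCS setCK subset1; apply/orP; left.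
  rewrite eq_sym eqEcard sub1set eA cards1.
  by have := cardsC A; rewrite card_ord; lia.
exact: (spanning_connectedS AE (ltnW V1) (conn e)).
Qed.

Lemma QMDS_exceptional : 3 <= sigma -> QMDS C -> m != sigma -> exceptional.
Proof.
move=> s3 qC ms; have [le_k lt_k] := sigma_bounds.
have sm := length_ge_sigma CH.
have V1 : 1 < #|V|.
  by have := leq_ltn_trans (leq0n _) (lt_k (ltnW (ltnW s3))); rewrite subn_gt0.
have deg := QMDS_degree CH V1 qC.
have sdeg := sum_degrees CH.
have dV : #|V| * (m - sigma).+1 <= m * h.+1.
  by rewrite -sdeg -sum_nat_const; apply: leq_sum => v _; apply: deg.
have NV : h * sigma.-1 + 2 <= #|V| by have := lt_k (ltnW (ltnW s3)); lia.
have [t [t0 mE]] : exists t, 0 < t /\ m = sigma + t by exists (m - sigma); lia.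
have [s sE] : exists s, sigma = s + 3 by exists (sigma - 3); lia.
have key : (h * (s + 2) + 2) * t.+1 <= (s + 3 + t) * h.+1.
  apply: leq_trans (leq_trans _ dV) _; last by rewrite mE sE.
  by apply: leq_mul; lia.
(* This is [key] with the terms in [t] collected. As [t >= 1], it yields [h * s <= s], so [s = 0]
   because [h >= 2]; then [t * (h + 1) <= h + 1] gives [t = 1]. *)
have key' : t * (h * (s + 1) + 1) <= h + s + 1 by nia.
have s0 : s = 0 by nia.
have t1 : t = 1 by nia.
have sigma3 : sigma = 3 by lia.
have m4 : m = 4 by lia.
(* [dV] and [NV] are now the two opposite bounds on [#|V|]. *)
have N2 : #|V| = 2 * h + 2 by move: dV NV; rewrite sigma3 m4 /=; lia.
split=> //; last first.
  move=> e; move/(QMDS_connectedP CH V1): qC; apply.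
  by rewrite cardsC1 card_ord; lia.
have deg2 v : 2 <= #|[set e | v \in H e]|.
  by apply: leq_trans (deg v); rewrite sigma3 m4.
(* Every degree is at least 2 and the sum is exactly [2 * #|V|], so equality holds at each
   vertex. *)
have eqdeg : \sum_(v : V) 2 == \sum_v #|[set e | v \in H e]|.
  by rewrite sdeg sum_nat_const N2; lia.
have /leqif_sum : forall v : V, true ->
    2 <= #|[set e | v \in H e]| ?= iff (2 == #|[set e | v \in H e]|).
  by move=> v _; split.
move/(fun le => le.2); rewrite /= eqdeg => /esym/forallP deg_eq v.
by have := deg_eq v => /= /eqP.
Qed.

(** For [sigma >= 3], distance at least 2 excludes [m = sigma] and leaves [m = 4]. For [sigma = 2],
    disjoint complements give [m * (#|V| - h.+1) <= #|V|], which is weakest at [#|V| = h + 2]. *)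
Lemma QMDS_length_bound :
  h + 1 < #|V| -> QMDS C -> 2 <= min_dist C -> m <= h + 2.
Proof.
move=> NV qC d2; have [le_k lt_k] := sigma_bounds.
have sm := length_ge_sigma CH.
have [s3|s2] := leqP 3 sigma.
  have ms : m != sigma by move: d2; have /(QMDS_sigmaE CH) -> := qC; lia.
  by have [_ m4 _ _ _] := QMDS_exceptional s3 qC ms; lia.
have {}s2 : sigma = 2.
  by apply/eqP; rewrite eqn_leq -ltnS s2 ltnNge ceil_div_leE //; lia.
have /(QMDS_sigma2 s2) disj := qC.
(* Incidences are counted by vertices: each vertex lies in at most one complement. *)
have : \sum_(e < m) #|~: H e| <= #|V|.
  under eq_bigr do rewrite -sum1_card; rewrite -[X in _ <= X]sum1_card.
  rewrite (exchange_big_dep xpredT) //=; apply: leq_sum => v _.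
  rewrite sum1_card leqNgt; apply/negP => /card_gt1P[e [f [ve vf ef]]].
  by have /negP[] := negbT (disjointFr (disj _ _ ef) ve).
under eq_bigr => e _.
  have -> : #|~: H e| = #|V| - h.+1.
    by rewrite -(hypergraphic_uniform CH e) -(cardsC (H e)) addKn.
  over.
rewrite sum_nat_const card_ord; nia.
Qed.

End Classification.

(** * A code of length [h + 2] that attains the bound *)

Section Example.
Variables (F : finFieldType) (L : fieldExtType F).
Hypothesis dimL_ge2 : 1 < \dim {:L}.
Local Notation h := (\dim {:L}).
Local Notation n := (h + 2).

(** Supplies enough evaluation points: [#|F| ^ h >= 2 ^ h >= h + 2] once [h >= 2]. *)
Lemma card_field_ge : n <= #|finvect_type L|.
Proof.
have -> : #|finvect_type L| = #|F| ^ h.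
  rewrite -(card_vspacef (Vector.class L : Vector.axioms_ F (finvect_type L))).
  exact: card_vspace.
have F2 := finNzRing_gt1 F.
suff le k : 1 < k -> k + 2 <= 2 ^ k.
  by apply: leq_trans (le _ dimL_ge2) _; rewrite leq_exp2r // ltnW.
elim: k => // k IH; case: k IH => // -[//|k] IH _; rewrite expnS.
by have := IH isT; lia.
Qed.

Definition ext_point (i : 'I_n) : L := 
  enum_val (A := finvect_type L) (widen_ord card_field_ge i).

Lemma ext_point_inj : injective ext_point.
Proof.
move=> i j eq_ij; apply/ord_inj.
have eq_w := @enum_val_inj (finvect_type L) (finvect_type L) _ _ eq_ij.
exact: (congr1 val eq_w).
Qed.

Local Open Scope ring_scope.

Definition line_word (x : L) (a : F) : {ffun 'I_n -> L} :=
  [ffun i => x + a *: ext_point i].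

(** [F^o] is [F] as a space over itself, so the domain has dimension [h + 1] over [F]. *)
Definition line_fun (p : L * F^o) := line_word p.1 p.2.

Fact line_fun_is_linear : linear line_fun.
Proof.
move=> a [x b] [y c]; apply/ffunP => i; rewrite !ffunE /=.
by rewrite scalerDl scalerDr scalerA addrACA.
Qed.

HB.instance Definition _ :=
  GRing.isLinear.Build F (L * F^o)%type {ffun 'I_n -> L} _ line_fun
    line_fun_is_linear.

Definition line_code : additive_code L n := limg (linfun line_fun).

Lemma line_codeP c : reflect (exists x a, c = line_word x a) (c \in line_code).
Proof.
apply: (iffP memv_imgP) => [[[x a] _ ->]|[x [a ->]]].
  by exists x, a; rewrite lfunE.
by exists (x, a); rewrite ?memvf ?lfunE.
Qed.

Lemma line_code_faithful : faithful_code line_code.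
Proof.
move=> i x; exists (line_word x 0); first by apply/line_codeP; exists x, 0.
by rewrite ffunE scale0r addr0.
Qed.

(** Subtracting the two equations leaves [a] times the difference of two distinct points. *)
Lemma line_word_two_zeros x a i j : i != j ->
  line_word x a i = 0 -> line_word x a j = 0 -> x = 0 /\ a = 0.
Proof.
move=> ij; rewrite !ffunE => xi xj.
have : a *: (ext_point i - ext_point j) = 0.
  rewrite scalerBr (_ : a *: ext_point i = a *: ext_point j) ?subrr //.
  by apply: (addrI x); rewrite xi xj.
move/eqP; rewrite scaler_eq0 subr_eq0 (inj_eq ext_point_inj) (negPf ij) orbF.
by move/eqP => a0; move: xi; rewrite a0 scale0r addr0.
Qed.

Local Close Scope ring_scope.

Lemma shortened_line_code (A : {set 'I_n}) : 1 < #|A| -> shortened line_code A = 0%VS.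
Proof.
case/card_gt1P => i [j [iA jA ij]].
apply/eqP; rewrite -subv0; apply/subvP => c; rewrite mem_shortened memv0.
case/andP => /line_codeP[x [a ->]] /forall_inP z.
have [->->] := line_word_two_zeros ij (eqP (z _ iA)) (eqP (z _ jA)).
by apply/eqP/ffunP => k; rewrite !ffunE GRing.scale0r GRing.addr0.
Qed.

Lemma dim_line_code : \dim line_code = h.+1.
Proof.
rewrite limg_dim_eq; last first.
  apply/eqP; rewrite capfv -subv0; apply/subvP => -[x a].
  rewrite memv_ker lfunE /= memv0 => /eqP/ffunP z.
  have /card_gt1P[i [j [_ _ ij]]] : 1 < #|'I_n| by rewrite card_ord addn2.
  have [|| -> ->] := @line_word_two_zeros x a i j ij => //.
    by have := z i; rewrite [RHS]ffunE.
  by have := z j; rewrite [RHS]ffunE.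
by rewrite dimvf /dim /= -dimvf addn1.
Qed.

Fact punctured_neq0 (i : 'I_n) : ~: [set i] != set0.
Proof. by rewrite -card_gt0 cardsC1 card_ord addn2. Qed.

Definition punctured_hypergraph : hypergraph 'I_n 'I_n :=
  Hypergraph punctured_neq0.

Lemma punctured_connected (A : {set 'I_n}) :
  1 < #|A| -> spanning_connected punctured_hypergraph A.
Proof.
case/card_gt1P => i [j [iA jA ij]].
apply: (spanning_connected_two iA jA); rewrite /=.
  by apply/setP => k; rewrite !inE; case: (eqVneq k i) => //= ->.
by rewrite !cardsC1 card_ord; lia.
Qed.

(** Both rank functions depend only on [#|A|]: they are 0 on the empty set, [h] on singletons and
    [h + 1] beyond. *)
Lemma line_code_hypergraphic : connected_hypergraphic line_code punctured_hypergraph.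
Proof.
have uH : underlying_hypergraph line_code punctured_hypergraph.
  move=> A; have [A0|/card_gt0P[i iA]] := posnP #|A|.
    by rewrite (cards0_eq A0) hrank0 /code_rank shortened0 subnn.
  have [A1|A1] := leqP #|A| 1.
    have -> : A = [set i].
      by apply/esym/eqP; rewrite eqEcard sub1set iA cards1.
    rewrite hrank1 code_rank1; last exact: line_code_faithful.
    by rewrite /= cardsC1 card_ord; lia.
  rewrite /code_rank shortened_line_code // dimv0 dim_line_code /hrank.
  by rewrite (punctured_connected A1) card_ord; lia.
split=> //; first exact: line_code_faithful.
  split; last by exists 'I_n, punctured_hypergraph.
  move=> i; have [c cC ci] := line_code_faithful i 1%R.
  by exists c; rewrite // ci GRing.oner_neq0.
by apply: punctured_connected; rewrite cardsT card_ord addn2.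
Qed.

(** Here [#|V| - 1 = h + 1] lies in the range of [sigma = 2], and the complements of the edges are
    distinct points, so the criterion for that case applies. *)
Lemma line_code_QMDS : QMDS line_code /\ 2 <= min_dist line_code.
Proof.
have s2 : ceil_div (#|'I_n| - 1) h = 2.
  apply/eqP; rewrite eqn_leq ltnNge !ceil_div_leE ?(ltnW dimL_ge2) //.
  by rewrite card_ord; lia.
have qC : QMDS line_code.
  apply: (proj2 (QMDS_sigma2 line_code_hypergraphic dimL_ge2 s2)) => e f ef.
  by rewrite /= !setCK disjoints1 inE.
split=> //; have /(QMDS_sigmaE line_code_hypergraphic) -> := qC.
by rewrite s2; lia.
Qed.

End Example.

(** * The classification and the attaining example put together *)

Theorem theorem5p8 (q h : nat) (q_pp : prime_power q) (h_ge2 : 2 <= h)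
    (F : finFieldType) (L : fieldExtType F)
    (cardF : #|F| = q) (dimL : \dim {:L} = h) :
  (forall (m : nat) (C : additive_code L m)
          (V : finType) (H : hypergraph V 'I_m),
     connected_hypergraphic C H ->
     let N := #|V| in
     let sigma := ceil_div (N - 1) h in
     let exceptional :=
       [/\ sigma = 3, m = 4, N = 2 * h + 2,
           (forall v : V, #|[set e : 'I_m | v \in H e]| = 2)
         & (forall e : 'I_m, spanning_connected H (~: [set e]))] in
     [/\ huniform H h.+1 /\ \dim C = N - 1,
         (sigma = 1 ->
            [/\ N = h + 1, (forall e : 'I_m, H e = [set: V]), QMDS C
              & min_dist C = m]),
         (sigma = 2 ->
            (QMDS C <-> (forall e f : 'I_m, e != f ->
                           [disjoint ~: H e & ~: H f])) /\
            (QMDS C -> min_dist C = m - 1)),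
         (3 <= sigma ->
            [/\ QMDS C <-> (m = sigma \/ exceptional),
                (m = sigma -> min_dist C = 1)
              & (exceptional -> min_dist C = 2)])
       & (h + 1 < N -> QMDS C -> 2 <= min_dist C -> m <= h + 2)]) /\
  (exists (C : additive_code L (h + 2))
          (V : finType) (H : hypergraph V 'I_(h + 2)),
     [/\ connected_hypergraphic C H, h + 1 < #|V|, QMDS C & 2 <= min_dist C]).
Proof.
subst q h; split; last first.
  exists (line_code h_ge2), 'I_(\dim {:L} + 2), (punctured_hypergraph L).
  have [qC d2] := line_code_QMDS h_ge2.
  by split=> //; [exact: line_code_hypergraphic | rewrite card_ord; lia].
move=> m C V H CH N sigma exc.
have qE : QMDS C <-> min_dist C = m - sigma + 1 := QMDS_sigmaE CH.
split.
- by split; [exact: hypergraphic_uniform CH | exact: hypergraphic_dim CH].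
- exact: QMDS_sigma1 CH h_ge2.
- move=> s2; split; first exact: QMDS_sigma2.
  rewrite qE; have : sigma <= m := length_ge_sigma CH.
  by rewrite s2; lia.
- move=> s3.
  have V1 : 1 < #|V|.
    have [_ lt_k] := sigma_bounds V h_ge2.
    by have := leq_ltn_trans (leq0n _) (lt_k (ltnW (ltnW s3))); rewrite subn_gt0.
  have full := QMDS_length_eq_sigma CH V1; have exq := exceptional_QMDS CH h_ge2.
  split; [split; last by case=> [/full|/exq] | |].
  + move=> qC; have [->|ms] := eqVneq m sigma; first by left.
    by right; exact: (QMDS_exceptional CH h_ge2 s3 qC ms).
  + by move=> ms; have /qE -> := full ms; lia.
  + by move=> ex; have /qE -> := exq ex; case: ex => -> m4 _ _ _; lia.
- exact: (QMDS_length_bound CH h_ge2).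
Qed.
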